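(* Let $n_1\le n_2$ and let $\bar X,\bar Y\in\mathbb{R}^{n_1\times n_2}$ with $\bar Y\in\partial\|\bar X\|_*$. Let $\gamma=\gamma(\bar Y)=\max\{\sigma(\bar Y)\setminus\{1\},0\}<1$ be the largest singular value of $\bar Y$ different from $1$ (and $\gamma=0$ if there is none). Then for any $X\in\mathbb{R}^{n_1\times n_2}\setminus\{0\}$, $$\|X\|_*-\|\bar X\|_*-\langle\bar Y,X-\bar X\rangle\ge\frac{1-\gamma^2}{2\|X\|_*(1+(1+\gamma)^2)}\left[\mathrm{dist}\left(X;(\partial\|\cdot\|_* )^{-1}(\bar Y)\right)\right]^2.$$ Consequently, $$\|X\|_*-\|\bar X\|_*-\langle\bar Y,X-\bar X\rangle\ge\frac{1-\gamma}{5\|X\|_*}\left[\mathrm{dist}\left(X;(\partial\|\cdot\|_* )^{-1}(\bar Y)\right)\right]^2\quad\text{for all }X\in\mathbb{R}^{n_1\times n_2}\setminus\{0\}.$$ Finally, the nuclear norm satisfies the quadratic growth condition around $(\bar X,\bar Y)$ for the set $$\mathcal{M}_*=\{Y\in\mathbb{R}^{n_1\times n_2}:\sigma_1(Y)=\dots=\sigma_p(Y)=1\},$$ where $p=p(\bar Y)$ is the number of singular values of $\bar Y$ equal to $1$.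
   Context: $\|X\|_*$ is the nuclear norm (sum of the singular values), $\sigma_1(X)\ge\dots\ge\sigma_{n_1}(X)$ are the singular values of $X$ in nonincreasing order, $\sigma(\bar Y)$ denotes the set of singular values of $\bar Y$, $\langle\cdot,\cdot\rangle$ is the trace inner product, and $\mathrm{dist}$ is the distance in the Frobenius norm. $\partial$ is the convex subdifferential and $(\partial\|\cdot\|_* )^{-1}(Y)=\{X: Y\in\partial\|X\|_*\}$. Quadratic growth: a proper lower semicontinuous convex function $g$ satisfies the quadratic growth condition at $x$ for $y\in\partial g(x)$ with modulus $\kappa>0$ if there is $\varepsilon>0$ such that $g(u)-g(x)-\langle y,u-x\rangle\ge\frac{\kappa}{2}[\mathrm{dist}(u;(\partial g)^{-1}(y))]^2$ for all $u\in\mathbb{B}_\varepsilon(x)$ (open ball). For a set $\mathcal{M}$ containing $\bar y$, $g$ satisfies the quadratic growth condition around $(\bar x,\bar y)\in\mathrm{gph}\,\partial g$ for $\mathcal{M}$ if there exist $\eta,\kappa>0$ such that for every $(x,y)\in\mathrm{gph}\,\partial g\cap\mathbb{B}_\eta(\bar x,\bar y)$ with $y\in\mathcal{M}$, $g$ satisfies the quadratic growth condition at $x$ for $y$ with the same modulus $\kappa$. *)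

(* Defs.v *)
From mathcomp Require Import all_boot all_order all_algebra.
From mathcomp Require Import polyrcf.
From mathcomp Require Import boolp classical_sets reals.

Set Implicit Arguments.
Unset Strict Implicit.
Unset Printing Implicit Defensive.

Import Order.TTheory GRing.Theory Num.Theory.

Local Open Scope classical_set_scope.
Local Open Scope ring_scope.

(* Square roots of the eigenvalues of A A^T, each repeated according to its
   multiplicity as a root of the characteristic polynomial, in nonincreasing
   order. This is the list of the min(m, n) singular values when m <= n;
   for m > n it would contain m - n extra zeros. *)
Definition singular_values (R : realType) (m n : nat) (A : 'M[R]_(m, n)) :
    seq R :=
  let p := char_poly (A *m A^T) in
  sort (fun x y => y <= x)
    (flatten [seq nseq (mup x p) (Num.sqrt x) | x <- rootsR p]).

(* 0-based: the usual sigma_(i+1). *)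
Definition sigma (R : realType) (m n : nat) (A : 'M[R]_(m, n)) (i : nat) : R :=
  nth 0 (singular_values A) i.

Definition nuclear_norm (R : realType) (m n : nat) (A : 'M[R]_(m, n)) : R :=
  \sum_(s <- singular_values A) s.

Definition inner (R : realType) (m n : nat) (A B : 'M[R]_(m, n)) : R :=
  \tr (A^T *m B).

Definition fro_norm (R : realType) (m n : nat) (A : 'M[R]_(m, n)) : R :=
  Num.sqrt (inner A A).

(* inf set0 = 0, so this is the distance only for nonempty S; below it is
   applied to the sets (\partial g)^-1(y) with y a subgradient of g at some
   point. *)
Definition dist (R : realType) (m n : nat) (X : 'M[R]_(m, n))
    (S : set 'M[R]_(m, n)) : R :=
  inf [set fro_norm (X - Z) | Z in S].

Definition subdifferential (R : realType) (m n : nat)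
    (g : 'M[R]_(m, n) -> R) (x : 'M[R]_(m, n)) : set 'M[R]_(m, n) :=
  [set y | forall u, g x + inner y (u - x) <= g u].

Definition subdifferential_inv (R : realType) (m n : nat)
    (g : 'M[R]_(m, n) -> R) (y : 'M[R]_(m, n)) : set 'M[R]_(m, n) :=
  [set x | subdifferential g x y].

Definition quadratic_growth_at (R : realType) (m n : nat)
    (g : 'M[R]_(m, n) -> R) (x y : 'M[R]_(m, n)) (kappa : R) : Prop :=
  [/\ 0 < kappa, subdifferential g x y &
    exists2 eps : R, 0 < eps &
      forall u, fro_norm (u - x) < eps ->
        kappa / 2 * dist u (subdifferential_inv g y) ^+ 2
          <= g u - g x - inner y (u - x)].

(* The ball in the product space is taken for the Euclidean product norm. *)
Definition quadratic_growth_around (R : realType) (m n : nat)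
    (g : 'M[R]_(m, n) -> R) (xbar ybar : 'M[R]_(m, n))
    (M : set 'M[R]_(m, n)) : Prop :=
  [/\ subdifferential g xbar ybar, M ybar &
    exists eta kappa : R, [/\ 0 < eta, 0 < kappa &
      forall x y, subdifferential g x y ->
        Num.sqrt (fro_norm (x - xbar) ^+ 2 + fro_norm (y - ybar) ^+ 2) < eta ->
        M y -> quadratic_growth_at g x y kappa]].

Definition gamma (R : realType) (m n : nat) (Y : 'M[R]_(m, n)) : R :=
  \big[Num.max/0]_(s <- singular_values Y | s != 1) s.

Definition num_sigma1 (R : realType) (m n : nat) (Y : 'M[R]_(m, n)) : nat :=
  count_mem 1 (singular_values Y).

Definition Mstar (R : realType) (m n : nat) (p : nat) : set 'M[R]_(m, n) :=
  [set Y | forall i, (i < p)%N -> sigma Y i = 1].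

(* Main.v *)
Require Import Defs.
From mathcomp Require Import all_boot all_order all_algebra.
From mathcomp Require Import boolp classical_sets reals.
From mathcomp Require Import polyrcf complex.
From mathcomp Require Import ring lra.
Import Order.TTheory GRing.Theory Num.Theory.
Local Open Scope classical_set_scope.
Local Open Scope ring_scope.

(** Duality gives both halves of the argument. The nuclear norm is the support
    function of the contractions, i.e. of the matrices of operator norm at most
    1 ([contraction_le_nuclear], [nuclear_attained]). Hence Y is a subgradient
    at X exactly when Y is a contraction and <Y, X> = ||X||_*
    ([subdifferential_nuclear]), and the growth gap at Xbar is just
    ||X||_* - <Ybar, X>, which does not involve Xbar.

    Let Y be a contraction and write X = sum_i s_i p_i^T q_i (singular value
    decomposition; vectors are rows, so matrices act on the right). The gap
    is sum_i s_i (1 - <p_i Y, q_i>), a combination of gaps of rank-one unit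
    matrices. For one term, [rank_one_growth] finds a vector c fixed by Y Y^T
    such that 1 - <p Y, q> is at least (1 - gamma) / 2 times the squared
    distance from p^T q to c^T c Y. The matrix Z = sum_i s_i c_i^T c_i Y lies in
    the inverse subdifferential at Y, because
    ||Z||_* <= sum_i s_i |c_i| |c_i Y| = sum_i s_i |c_i|^2 = <Y, Z>.
    Convexity of the squared norm ([inner_jensen]) then bounds |X - Z|^2 by
    ||X||_* times the sum of the rank-one errors weighted by s_i, which yields
    [nuclear_growth]:

      (1 - gamma) / 2 * dist(X)^2 <= ||X||_* (||X||_* - <Y, X>).

    Both explicit estimates follow, as 1 + gamma <= 1 + (1 + gamma)^2 and
    2 <= 5.

    For the growth around (Xbar, Ybar), the same inequality is used at nearby
    pairs (x, y), and only gamma(y) has to be kept away from 1. When y has at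
    least as many unit singular values as Ybar, a dimension count as in the
    Courant-Fischer principle gives gamma(y) <= gamma(Ybar) + |y - Ybar|
    ([gamma_perturb]). *)

Section NuclearNorm.
Set Implicit Arguments.
Unset Strict Implicit.
Variable R : realType.

(** * The trace inner product *)

Lemma innerE m n (A B : 'M[R]_(m, n)) :
  inner A B = \sum_i \sum_j A i j * B i j.
Proof.
rewrite /inner /mxtrace exchange_big; apply: eq_bigr => j _.
by rewrite mxE; apply: eq_bigr => i _; rewrite mxE.
Qed.

Lemma innerC m n (A B : 'M[R]_(m, n)) : inner A B = inner B A.
Proof. by rewrite !innerE; do 2!apply: eq_bigr => ? _; rewrite mulrC. Qed.

Lemma innerDr m n (A B C : 'M[R]_(m, n)) :
  inner A (B + C) = inner A B + inner A C.
Proof. by rewrite /inner mulmxDr mxtraceD. Qed.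

Lemma innerBr m n (A B C : 'M[R]_(m, n)) :
  inner A (B - C) = inner A B - inner A C.
Proof. by rewrite /inner mulmxBr linearB. Qed.

Lemma innerZr m n a (A B : 'M[R]_(m, n)) : inner A (a *: B) = a * inner A B.
Proof. by rewrite /inner -scalemxAr mxtraceZ. Qed.

Lemma inner0r m n (A : 'M[R]_(m, n)) : inner A 0 = 0.
Proof. by rewrite /inner mulmx0 mxtrace0. Qed.

Lemma innerDl m n (A B C : 'M[R]_(m, n)) :
  inner (A + B) C = inner A C + inner B C.
Proof. by rewrite innerC innerDr !(innerC C). Qed.

Lemma innerBl m n (A B C : 'M[R]_(m, n)) :
  inner (A - B) C = inner A C - inner B C.
Proof. by rewrite innerC innerBr !(innerC C). Qed.

Lemma innerZl m n a (A B : 'M[R]_(m, n)) : inner (a *: A) B = a * inner A B.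
Proof. by rewrite innerC innerZr innerC. Qed.

Lemma inner0l m n (A : 'M[R]_(m, n)) : inner 0 A = 0.
Proof. by rewrite innerC inner0r. Qed.

Lemma inner_sumr m n I (r : seq I) (P : pred I) (A : 'M[R]_(m, n)) F :
  inner A (\sum_(i <- r | P i) F i) = \sum_(i <- r | P i) inner A (F i).
Proof. by rewrite /inner mulmx_sumr linear_sum. Qed.

(** The subtraction rules come first: a difference is a sum with an opposite, so
    the addition rules would otherwise apply to it. *)
Definition inner_lin := (innerBr, innerBl, innerDr, innerDl, innerZr, innerZl).

Lemma inner_sqrB m n (A B : 'M[R]_(m, n)) :
  inner (A - B) (A - B) = inner A A - 2 * inner A B + inner B B.
Proof. by rewrite !inner_lin (innerC B A); ring. Qed.

Lemma inner_ge0 m n (A : 'M[R]_(m, n)) : 0 <= inner A A.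
Proof.
rewrite innerE sumr_ge0// => i _; rewrite sumr_ge0// => j _; exact: sqr_ge0.
Qed.

Lemma inner_eq0 m n (A : 'M[R]_(m, n)) : inner A A = 0 -> A = 0.
Proof.
rewrite innerE => /psumr_eq0P H; apply/matrixP => i j; rewrite mxE.
have /psumr_eq0P : \sum_j A i j * A i j = 0.
  by apply: H => // k _; rewrite sumr_ge0// => l _; exact: sqr_ge0.
move=> /(_ (fun _ _ => sqr_ge0 _) j isT) /eqP.
by rewrite mulf_eq0 orbb => /eqP.
Qed.

Lemma inner_mull m n p (M : 'M[R]_(p, m)) (A : 'M[R]_(m, n)) B :
  inner (M *m A) B = inner A (M^T *m B).
Proof. by rewrite /inner trmx_mul -mulmxA. Qed.

Lemma inner_mulr m n p (M : 'M[R]_(n, p)) (A : 'M[R]_(m, n)) B :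
  inner (A *m M) B = inner A (B *m M^T).
Proof. by rewrite /inner trmx_mul -mulmxA mxtrace_mulC mulmxA. Qed.

Lemma inner_outer m n (Y : 'M[R]_(m, n)) (u : 'rV_m) (v : 'rV_n) :
  inner Y (u^T *m v) = inner (u *m Y) v.
Proof. by rewrite inner_mull. Qed.

Lemma inner_outer_outer m n (x z : 'rV[R]_m) (y t : 'rV[R]_n) :
  inner (x^T *m y) (z^T *m t) = inner x z * inner y t.
Proof.
rewrite inner_outer mulmxA; have -> : z *m x^T = (inner x z)%:M.
  by rewrite [LHS]mx11_scalar /inner mxtrace_mulC trace_mx11.
by rewrite mul_scalar_mx innerZl.
Qed.

Lemma inner_rows m n (A B : 'M[R]_(m, n)) :
  inner A B = \sum_i inner (row i A) (row i B).
Proof.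
rewrite innerE; apply: eq_bigr => i _; rewrite innerE big_ord1.
by apply: eq_bigr => j _; rewrite !mxE.
Qed.

Lemma inner_rowE n (u v : 'rV[R]_n) : inner u v = \sum_i u 0 i * v 0 i.
Proof. by rewrite innerE big_ord1. Qed.

Lemma inner_cauchy m n (A B : 'M[R]_(m, n)) :
  inner A B ^+ 2 <= inner A A * inner B B.
Proof.
have [/inner_eq0 ->|B0] := eqVneq (inner B B) 0.
  by rewrite !inner0r mulr0 expr0n.
have Bp : 0 < inner B B by rewrite lt0r B0 inner_ge0.
have := inner_ge0 (inner B B *: A - inner A B *: B).
rewrite !inner_lin (innerC B A) => ge0.
rewrite -subr_ge0 -(pmulr_rge0 _ Bp); apply: le_trans ge0 _.
by rewrite le_eqVlt; apply/orP; left; apply/eqP; ring.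
Qed.

Lemma fro_ge0 m n (A : 'M[R]_(m, n)) : 0 <= fro_norm A.
Proof. exact: sqrtr_ge0. Qed.

Lemma sqr_fro m n (A : 'M[R]_(m, n)) : fro_norm A ^+ 2 = inner A A.
Proof. by rewrite sqr_sqrtr// inner_ge0. Qed.

Lemma inner_le_fro m n (A B : 'M[R]_(m, n)) :
  inner A B <= fro_norm A * fro_norm B.
Proof.
apply: le_trans (ler_norm _) _; rewrite -sqrtr_sqr -sqrtrM ?inner_ge0//.
by rewrite ler_sqrt ?mulr_ge0 ?inner_ge0// inner_cauchy.
Qed.

Lemma fro_triangle m n (A B : 'M[R]_(m, n)) :
  fro_norm (A + B) <= fro_norm A + fro_norm B.
Proof.
rewrite -(ler_pXn2r (n := 2))// ?nnegrE ?addr_ge0 ?fro_ge0// sqr_fro sqrrD !sqr_fro.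
rewrite !inner_lin (innerC B A).
have := inner_le_fro A B; lra.
Qed.

Lemma fro_outer m n (u : 'rV[R]_m) (v : 'rV[R]_n) :
  fro_norm (u^T *m v) = fro_norm u * fro_norm v.
Proof. by rewrite /fro_norm inner_outer_outer sqrtrM ?inner_ge0. Qed.

Lemma fro_mul m n (u : 'rV[R]_m) (A : 'M[R]_(m, n)) :
  fro_norm (u *m A) <= fro_norm u * fro_norm A.
Proof.
have := inner_le_fro A (u^T *m (u *m A)).
rewrite inner_outer -sqr_fro fro_outer.
have := fro_ge0 (u *m A); rewrite le_eqVlt => /predU1P[<- _|f0].
  by rewrite mulr_ge0 ?fro_ge0.
by rewrite expr2 mulrA ler_pM2r// mulrC.
Qed.

(** Convexity of the squared norm, with weights that need not sum to 1. Both
    sides expand into double sums over t_i t_j, compared term by term through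
    2 <D_i, D_j> <= |D_i|^2 + |D_j|^2. *)
Lemma inner_jensen m n (I : finType) (t : I -> R) (D : I -> 'M[R]_(m, n)) :
  (forall i, 0 <= t i) ->
  inner (\sum_i t i *: D i) (\sum_i t i *: D i)
    <= (\sum_i t i) * \sum_i t i * inner (D i) (D i).
Proof.
move=> t0; have [a aE] : exists a, forall i, inner (D i) (D i) = a i by eexists.
under [X in _ <= _ * X]eq_bigr => i _ do rewrite aE.
have -> : (\sum_i t i) * (\sum_i t i * a i)
    = \sum_i \sum_j t i * t j * ((a i + a j) / 2).
  transitivity (2^-1 * ((\sum_i t i * a i) * (\sum_j t j)) +
                2^-1 * ((\sum_i t i) * (\sum_j t j * a j))); first by field.
  rewrite !big_distrlr !mulr_sumr -big_split; apply: eq_bigr => i _ /=.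
  by rewrite !mulr_sumr -big_split; apply: eq_bigr => j _ /=; field.
rewrite inner_sumr; apply: ler_sum => i _; rewrite innerC inner_sumr.
apply: ler_sum => j _; rewrite innerZl innerZr mulrA ler_wpM2l ?mulr_ge0//.
by have := inner_ge0 (D i - D j); rewrite inner_sqrB !aE; lra.
Qed.

(** * The spectral theorem for real symmetric matrices *)

(** A complex eigenvalue l exists; split an eigenvector as x + iy with x and y
    real. Comparing <xA, y> with <x, yA> gives Im l (|x|^2 + |y|^2) = 0, so l is
    real and the nonzero one of x, y is a real eigenvector. *)
Lemma symmetric_eigenvector n (A : 'M[R]_n.+1) : A^T = A ->
  exists (a : R) (v : 'rV_n.+1), inner v v = 1 /\ v *m A = a *: v.
Proof.
move=> symA.
pose AC := map_mx (real_complex R) A.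
have /closed_rootP [l] : size (char_poly AC) != 1 by rewrite size_char_poly.
rewrite -eigenvalue_root_char => /eigenvalueP [w wA w0].
pose x : 'rV[R]_n.+1 := \row_i complex.Re (w 0 i).
pose y : 'rV[R]_n.+1 := \row_i complex.Im (w 0 i).
(* real and imaginary parts of w A = l w *)
have xA : x *m A = complex.Re l *: x - complex.Im l *: y.
  apply/rowP => j; have /rowP/(_ j)/(congr1 (@complex.Re R)) := wA.
  rewrite !mxE raddf_sum /=.
  under eq_bigr => k _ do rewrite mxE.
  case: (l) (w 0 j) => [a b] [c d] /= <-.
  by apply: eq_bigr => k _; rewrite !mxE; case: (w 0 k) => [e f] /=; ring.
have yA : y *m A = complex.Im l *: x + complex.Re l *: y.
  apply/rowP => j; have /rowP/(_ j)/(congr1 (@complex.Im R)) := wA.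
  rewrite !mxE raddf_sum /=.
  under eq_bigr => k _ do rewrite mxE.
  case: (l) (w 0 j) => [a b] [c d] /=; rewrite [RHS]addrC => <-.
  by apply: eq_bigr => k _; rewrite !mxE; case: (w 0 k) => [e f] /=; ring.
have normalise a (v : 'rV_n.+1) : v != 0 -> v *m A = a *: v ->
    exists (a : R) (v : 'rV_n.+1), inner v v = 1 /\ v *m A = a *: v.
  move=> v0 vA; exists a, ((fro_norm v)^-1 *: v); split; last first.
    by rewrite -scalemxAl vA !scalerA mulrC.
  rewrite !inner_lin mulrA -expr2 exprVn sqr_fro mulVf//.
  by apply: contraNneq v0 => /inner_eq0 ->.
have := inner_mulr A x y; rewrite symA xA yA.
rewrite !inner_lin => sym_xy.
have xy0 : (x != 0) || (y != 0).
  apply: contraNT w0; rewrite negb_or !negbK => /andP[/eqP/rowP x0 /eqP/rowP y0].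
  apply/eqP/rowP => j; move: (x0 j) (y0 j); rewrite !mxE.
  by case: (w 0 j) => ? ? /= -> ->.
have l0 : complex.Im l = 0.
  have /eqP : complex.Im l * (inner x x + inner y y) = 0 by lra.
  rewrite mulf_eq0 => /orP[/eqP//|].
  rewrite paddr_eq0 ?inner_ge0// => /andP[/eqP/inner_eq0 x0 /eqP/inner_eq0 y0].
  by rewrite x0 y0 eqxx in xy0.
rewrite l0 !scale0r subr0 add0r in xA yA.
by case/orP: xy0 => z0; [apply: normalise z0 xA | apply: normalise z0 yA].
Qed.

(** A symmetric orthogonal matrix with prescribed first row v: the reflection
    that exchanges the first basis vector e and v, whose mirror is orthogonal to
    e - v. *)
Lemma householder n (v : 'rV[R]_n.+1) : inner v v = 1 ->
  exists H : 'M[R]_n.+1, [/\ H^T = H, H *m H = 1%:M & delta_mx 0 0 *m H = v].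
Proof.
move=> v1; pose e : 'rV[R]_n.+1 := delta_mx 0 0; rewrite -/e.
have e1 : inner e e = 1.
  rewrite inner_rowE (bigD1 0)//= big1 ?mxE ?eqxx ?mulr1 ?addr0// => i /negPf i0.
  by rewrite mxE i0 andbF mul0r.
have [w0|w0] := eqVneq (inner (e - v) (e - v)) 0.
  exists 1%:M; rewrite trmx1 mulmx1; split=> //.
  by rewrite mulmx1; apply/eqP; rewrite -subr_eq0; apply/eqP/inner_eq0.
have [w wE] : exists w, w = e - v by exists (e - v).
rewrite -wE in w0.
have ww : w *m w^T = (inner w w)%:M.
  by rewrite [LHS]mx11_scalar /inner mxtrace_mulC trace_mx11.
have ew : e *m w^T = (inner w w / 2)%:M.
  rewrite [LHS]mx11_scalar; congr (_%:M).
  have -> : (e *m w^T) 0 0 = inner e w by rewrite /inner mxtrace_mulC trace_mx11 mxE;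
    rewrite mxE; apply: eq_bigr => i _; rewrite !mxE mulrC.
  by rewrite wE !inner_lin (innerC v e) v1 e1; lra.
exists (1%:M - (2 / inner w w) *: (w^T *m w)); split.
- by rewrite linearB linearZ /= trmx1 trmx_mul trmxK.
- rewrite mulmxBl mul1mx mulmxBr mulmx1 -scalemxAl -scalemxAr -mulmxA (mulmxA w).
  rewrite ww mul_scalar_mx -scalemxAr; set W := w^T *m w.
  by apply/matrixP => i j; rewrite !mxE; field.
- rewrite mulmxBr mulmx1 -scalemxAr mulmxA ew mul_scalar_mx scalerA.
  have -> : 2 / inner w w * (inner w w / 2) = 1 by field.
  by rewrite scale1r wE subKr.
Qed.

(** Deflation: conjugating by the reflection of a unit eigenvector makes A block
    diagonal, with a scalar block and a smaller symmetric block. *)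
Lemma symmetric_spectral n (A : 'M[R]_n) : A^T = A ->
  exists (O : 'M[R]_n) (d : 'rV[R]_n),
    O *m O^T = 1%:M /\ A = O^T *m diag_mx d *m O.
Proof.
elim: n A => [|n IHn] A symA.
  exists 1%:M, 0; rewrite trmx1 mulmx1; split=> //.
  by apply/matrixP => [[]].
have [a [v [v1 vA]]] := symmetric_eigenvector symA.
have [H [symH HH eH]] := householder v1.
have [B BE] : exists B : 'M[R]_(1 + n), B = H *m A *m H by exists (H *m A *m H).
have symB : B^T = B by rewrite BE !trmx_mul symA symH mulmxA.
have eB : delta_mx 0 0 *m B = a *: delta_mx 0 0 :> 'rV_(1 + n).
  by rewrite BE !mulmxA eH vA -scalemxAl -eH -mulmxA HH mulmx1.
have l0 : lshift n (0 : 'I_1) = (0 : 'I_n.+1) by apply: val_inj.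
have B0 j : B (lshift n 0) j = a * (j == lshift n 0)%:R.
  by rewrite l0; have /rowP/(_ j) := eB; rewrite -rowE !mxE eqxx.
have Bul : ulsubmx B = a%:M.
  by apply/matrixP => i j; rewrite !ord1 !mxE B0 eqxx mulr1.
have Bur : ursubmx B = 0.
  by apply/matrixP => i j; rewrite !ord1 !mxE B0 [_ == _](_ : _ = false) ?mulr0.
have Bdl : dlsubmx B = 0 by rewrite -{1}symB -trmx_ursub Bur trmx0.
have symC : (drsubmx B)^T = drsubmx B by rewrite trmx_drsub symB.
have [O [d [OO CE]]] := IHn _ symC.
have [P [PP BP]] : exists P : 'M[R]_(1 + n), P *m P^T = 1%:M /\
    B = P^T *m diag_mx (row_mx a%:M d) *m P.
  exists (block_mx 1%:M 0 0 O); split.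
    rewrite tr_block_mx mulmx_block !trmx0 trmx1 !mulmx0 !mul0mx !addr0 add0r.
    by rewrite mulmx1 OO -scalar_mx_block.
  rewrite -[LHS]submxK Bul Bur Bdl CE diag_mx_row tr_block_mx !trmx0 trmx1.
  rewrite !mulmx_block !(mul0mx, mulmx0, addr0, add0r) mul1mx mulmx1.
  by congr block_mx; apply/matrixP => i j; rewrite !ord1 !mxE eqxx.
exists (P *m H), (row_mx a%:M d); split.
  by rewrite trmx_mul symH -mulmxA (mulmxA H) HH mul1mx.
have -> : A = H *m B *m H by rewrite BE !mulmxA HH mul1mx -mulmxA HH mulmx1.
by rewrite trmx_mul symH -!mulmxA; congr (H *m _); rewrite BP !mulmxA.
Qed.

(** * Singular value decomposition *)

(** Conjugation by O conjugates the characteristic matrix. *)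
Lemma char_poly_conj_diag m (O : 'M[R]_m) (d : 'rV[R]_m) : O *m O^T = 1%:M ->
  char_poly (O^T *m diag_mx d *m O) = \prod_(i < m) ('X - (d 0 i)%:P).
Proof.
move=> OO; have OTO := mulmx1C OO.
have -> : \prod_(i < m) ('X - (d 0 i)%:P) = char_poly (diag_mx d).
  rewrite char_poly_trig ?diag_mx_is_trig//.
  by apply: eq_bigr => i _; rewrite mxE eqxx.
rewrite /char_poly; have -> : char_poly_mx (O^T *m diag_mx d *m O) =
    map_mx polyC O^T *m char_poly_mx (diag_mx d) *m map_mx polyC O.
  rewrite /char_poly_mx !map_mxM mulmxBr mulmxBl; congr (_ - _).
  by rewrite mul_mx_scalar -scalemxAl -map_mxM OTO map_mx1 scalemx1.
by rewrite !det_mulmx mulrC mulrA -det_mulmx -map_mxM OO map_mx1 det1 mul1r.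
Qed.

(** Only the left singular vectors (the rows of O) are recorded. The rows of
    O *m Y are orthogonal of norms s 0 i, so they determine the right singular
    vectors as far as these are determined at all. *)
Definition left_svd m n (Y : 'M[R]_(m, n)) (O : 'M[R]_m) (s : 'rV[R]_m) : Prop :=
  [/\ O *m O^T = 1%:M, forall i, 0 <= s 0 i,
      (O *m Y) *m (O *m Y)^T = diag_mx (\row_i s 0 i ^+ 2) &
      perm_eq (singular_values Y) [seq s 0 i | i : 'I_m]].

Lemma left_svd_exists m n (Y : 'M[R]_(m, n)) : exists O s, left_svd Y O s.
Proof.
have symG : (Y *m Y^T)^T = Y *m Y^T by rewrite trmx_mul trmxK.
have [O [d [OO GE]]] := symmetric_spectral symG.
have GD : (O *m Y) *m (O *m Y)^T = diag_mx d.
  rewrite trmx_mul mulmxA -(mulmxA O) GE !mulmxA OO mul1mx -mulmxA OO mulmx1.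
  by [].
have d_ge0 i : 0 <= d 0 i.
  have /matrixP/(_ i i) := GD; rewrite !mxE eqxx mulr1n => <-.
  by apply: sumr_ge0 => k _; rewrite [_^T _ _]mxE; exact: sqr_ge0.
exists O, (\row_i Num.sqrt (d 0 i)); split=> //.
- by move=> i; rewrite mxE sqrtr_ge0.
- by rewrite GD; congr diag_mx; apply/rowP => i; rewrite !mxE sqr_sqrtr.
rewrite /singular_values GE char_poly_conj_diag// perm_sort.
set p := \prod_i _; pose ds := [seq d 0 i | i : 'I_m].
have pE : p = \prod_(x <- ds) ('X - x%:P) by rewrite /ds big_map big_enum.
have p0 : p != 0 by rewrite pE monic_neq0// monic_prod_XsubC.
have -> : [seq (\row_i0 Num.sqrt (d 0 i0)) 0 i | i : 'I_m]
    = map Num.sqrt ds.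
  by rewrite /ds -map_comp; apply: eq_map => i /=; rewrite mxE.
have roots_ds : perm_eq (rootsR p) (undup ds).
  apply: uniq_perm; rewrite ?undup_uniq ?uniq_roots// => x.
  by rewrite -(roots_on_rootsR p0) mem_undup pE root_prod_XsubC.
apply: perm_trans (perm_flatten (perm_map _ roots_ds)) _.
under eq_map => x do rewrite pE mu_prod_XsubC -map_nseq.
rewrite map_comp -map_flatten.
exact/perm_map/perm_count_undup.
Qed.

Lemma singular_values_ge0 m n (Y : 'M[R]_(m, n)) x :
  x \in singular_values Y -> 0 <= x.
Proof.
have [O [s [_ s0 _ sE]]] := left_svd_exists Y.
by rewrite (perm_mem sE) => /mapP[i _ ->].
Qed.

Section LeftSvd.
Variables (m n : nat) (Y : 'M[R]_(m, n)) (O : 'M[R]_m) (s : 'rV[R]_m).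
Hypothesis svdY : left_svd Y O s.

Lemma svd_row_inner i j :
  inner (row i (O *m Y)) (row j (O *m Y)) = s 0 i ^+ 2 *+ (i == j).
Proof.
have [_ _ /matrixP/(_ i j) + _] := svdY; rewrite !mxE => <-.
by rewrite inner_rowE; apply: eq_bigr => k _; rewrite !mxE.
Qed.

Lemma svd_fro_row i : fro_norm (row i (O *m Y)) = s 0 i.
Proof.
have [_ s0 _ _] := svdY.
by rewrite /fro_norm svd_row_inner eqxx mulr1n sqrtr_sqr ger0_norm.
Qed.

Lemma svd_fro_basis i : fro_norm (row i O) = 1.
Proof.
have [OO _ _ _] := svdY; rewrite /fro_norm [inner _ _](_ : _ = 1) ?sqrtr1//.
have /matrixP/(_ i i) := OO; rewrite !mxE eqxx mulr1n => <-.
by rewrite inner_rowE; apply: eq_bigr => k _; rewrite !mxE.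
Qed.

Lemma svd_inner_mul (u : 'rV[R]_m) : inner (u *m Y) (u *m Y) =
  \sum_i s 0 i ^+ 2 * (u *m O^T) 0 i ^+ 2.
Proof.
have [/mulmx1C OTO _ GD _] := svdY.
have -> : u *m Y = (u *m O^T) *m (O *m Y) by rewrite mulmxA -(mulmxA u) OTO mulmx1.
rewrite inner_mulr -mulmxA GD innerC inner_rowE; apply: eq_bigr => i _.
by rewrite mul_mx_diag !mxE; ring.
Qed.

Lemma svd_inner_basis (u : 'rV[R]_m) : inner u u = \sum_i (u *m O^T) 0 i ^+ 2.
Proof.
have [/mulmx1C OTO _ _ _] := svdY.
rewrite -{1}[u]mulmx1 -OTO mulmxA inner_mulr inner_rowE.
by apply: eq_bigr => i _; rewrite expr2.
Qed.

Lemma svd_nuclear : nuclear_norm Y = \sum_i s 0 i.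
Proof.
have [_ _ _ sE] := svdY.
by rewrite /nuclear_norm (perm_big _ sE) /= big_map big_enum.
Qed.

Lemma svd_inner X : inner X Y = \sum_i inner (row i O *m X) (row i (O *m Y)).
Proof.
have [/mulmx1C OTO _ _ _] := svdY.
rewrite -{1}[Y]mul1mx -OTO -mulmxA innerC inner_mull trmxK innerC inner_rows.
by apply: eq_bigr => i _; rewrite [row i (O *m X)]row_mul.
Qed.

Lemma svd_sum : Y = \sum_i (row i O)^T *m row i (O *m Y).
Proof.
have [/mulmx1C OTO _ _ _] := svdY.
rewrite -{1}[Y]mul1mx -OTO -mulmxA; apply/matrixP => i j.
rewrite summxE mxE; apply: eq_bigr => k _.
by rewrite [RHS]mxE big_ord1 !mxE.
Qed.

Lemma svd_mem i : s 0 i \in singular_values Y.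
Proof. by have [_ _ _ /perm_mem ->] := svdY; apply: map_f; rewrite mem_enum. Qed.

Lemma svd_count a : count_mem a (singular_values Y) = #|[pred i | s 0 i == a]|.
Proof.
have [_ _ _ /permP/(_ (pred1 a)) ->] := svdY.
rewrite -sum1_count big_map big_enum_cond -sum1_card /=.
by apply: eq_bigl => i; rewrite !inE.
Qed.

End LeftSvd.

(** * Duality between the nuclear norm and contractions *)

(** Operator norm at most 1, in bilinear form. *)
Definition contraction m n (W : 'M[R]_(m, n)) : Prop :=
  forall (u : 'rV[R]_m) (v : 'rV[R]_n), inner (u *m W) v <= fro_norm u * fro_norm v.

(** Each term of X = sum_i p_i^T (p_i X) pairs with W to at most |p_i| |p_i X| =
    s_i. *)
Lemma contraction_le_nuclear m n (W X : 'M[R]_(m, n)) :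
  contraction W -> inner W X <= nuclear_norm X.
Proof.
move=> contrW; have [O [s svdX]] := left_svd_exists X.
rewrite (svd_inner svdX) (svd_nuclear svdX); apply: ler_sum => i _.
by apply: le_trans (contrW _ _) _; rewrite (svd_fro_basis svdX) (svd_fro_row svdX) mul1r.
Qed.

(** With X = sum_i s_i p_i^T q_i, the dual certificate is sum_i p_i^T q_i over the
    i with s_i != 0; it is a contraction by Bessel's inequality for the q_i. *)
Lemma nuclear_attained m n (X : 'M[R]_(m, n)) :
  exists2 W, contraction W & inner W X = nuclear_norm X.
Proof.
have [O [s svdX]] := left_svd_exists X; have [OO s0 GD _] := svdX.
(* As 0^-1 = 0, the rows of Q with s_i = 0 vanish. *)
pose D := diag_mx (\row_i (s 0 i)^-1); pose Q := D *m (O *m X).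
have rowQ i : row i Q = (s 0 i)^-1 *: row i (O *m X).
  by rewrite /Q mul_diag_mx; apply/rowP => j; rewrite !mxE.
have QQ i j : (Q *m Q^T) i j = ((i == j) && (s 0 i != 0))%:R.
  have -> : (Q *m Q^T) i j = inner (row i Q) (row j Q).
    by rewrite inner_rowE mxE; apply: eq_bigr => k _; rewrite !mxE.
  rewrite !rowQ !inner_lin (svd_row_inner svdX).
  have [<-|] := eqVneq i j; last by rewrite !mulr0.
  by have [->|si0] := eqVneq (s 0 i) 0; rewrite /= ?invr0 ?mul0r// mulr1n; field.
have bessel (v : 'rV[R]_n) : fro_norm (v *m Q^T) <= fro_norm v.
  rewrite ler_sqrt ?inner_ge0//; set y := v *m Q^T.
  have vyQ : inner v (y *m Q) = inner y y by rewrite innerC inner_mulr.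
  clearbody y.
  have yQ : inner (y *m Q) (y *m Q) <= inner y y.
    rewrite inner_mulr -mulmxA inner_rowE [leRHS]inner_rowE.
    apply: ler_sum => i _; rewrite mxE (bigD1 i)//= big1 => [|j /negPf ji].
      by rewrite QQ eqxx addr0; case: (_ != _); rewrite ?mulr1 ?mulr0// sqr_ge0.
    by rewrite QQ ji mulr0.
  by have := inner_ge0 (v - y *m Q); rewrite (inner_sqrB v (y *m Q)) vyQ; lra.
exists (O^T *m Q) => [u v|].
  rewrite mulmxA inner_mulr; apply: le_trans (inner_le_fro _ _) _.
  rewrite ler_pM ?fro_ge0//.
  have OTO := mulmx1C OO.
  by rewrite /fro_norm inner_mulr trmxK -mulmxA OTO mulmx1.
rewrite inner_mull trmxK inner_rows (svd_nuclear svdX); apply: eq_bigr => i _.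
rewrite rowQ innerZl (svd_row_inner svdX) eqxx mulr1n.
by have [->|si0] := eqVneq (s 0 i) 0; [rewrite expr0n mulr0|field].
Qed.

Lemma nuclear_ge0 m n (X : 'M[R]_(m, n)) : 0 <= nuclear_norm X.
Proof.
have [O [s svdX]] := left_svd_exists X; have [_ s0 _ _] := svdX.
by rewrite (svd_nuclear svdX) sumr_ge0.
Qed.

Lemma nuclear0 m n : nuclear_norm (0 : 'M[R]_(m, n)) = 0.
Proof. by have [W _ <-] := nuclear_attained (0 : 'M[R]_(m, n)); rewrite inner0r. Qed.

Lemma nuclear_gt0 m n (X : 'M[R]_(m, n)) : X != 0 -> 0 < nuclear_norm X.
Proof.
move=> X0; rewrite lt0r nuclear_ge0 andbT; apply: contra_neq X0 => nX0.
have [O [s svdX]] := left_svd_exists X; have [_ s0 _ _] := svdX.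
have/psumr_eq0P sX0 : \sum_i s 0 i = 0 by rewrite -(svd_nuclear svdX).
apply: inner_eq0; rewrite (svd_inner svdX) big1// => i _.
rewrite (_ : row i (O *m X) = 0) ?inner0r//; apply: inner_eq0.
by rewrite (svd_row_inner svdX) sX0// expr0n mul0rn.
Qed.

Lemma nuclear_triangle m n (A B : 'M[R]_(m, n)) :
  nuclear_norm (A + B) <= nuclear_norm A + nuclear_norm B.
Proof.
have [W cW <-] := nuclear_attained (A + B).
by rewrite innerDr lerD// contraction_le_nuclear.
Qed.

(** A crude bound, enough to keep ||u||_* bounded near Xbar: each of the m
    singular values is at most the Frobenius norm. *)
Lemma nuclear_le_fro m n (A : 'M[R]_(m, n)) : nuclear_norm A <= m%:R * fro_norm A.
Proof.
have [O [s svdA]] := left_svd_exists A.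
have [/mulmx1C OTO s0 _ _] := svdA.
have -> : m%:R * fro_norm A = \sum_(i < m) fro_norm A.
  by rewrite sumr_const card_ord mulr_natl.
rewrite (svd_nuclear svdA).
apply: ler_sum => i _; rewrite -(svd_fro_row svdA) ler_sqrt ?inner_ge0//.
have -> : inner A A = inner (O *m A) (O *m A).
  by rewrite inner_mull mulmxA OTO mul1mx.
rewrite [leRHS]inner_rows (bigD1 i)//= lerDl sumr_ge0// => j _; exact: inner_ge0.
Qed.

(** The inequality nuclear_norm X <= inner Y X comes from the subgradient
    inequality at 0, and the contraction property from the one at X + u^T v. *)
Lemma subdifferential_nuclear m n (X Y : 'M[R]_(m, n)) :
  subdifferential (@nuclear_norm R m n) X Y <->
  contraction Y /\ nuclear_norm X <= inner Y X.
Proof.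
split=> [subY|[cY XY] U]; last first.
  by rewrite innerBr; have := contraction_le_nuclear U cY; lra.
split; last first.
  by have := subY 0; rewrite nuclear0 sub0r -scaleN1r innerZr; lra.
move=> u v; rewrite -inner_outer.
have [W cW WE] := nuclear_attained (u^T *m v).
have := subY (X + u^T *m v); rewrite [X + _ - X]addrC addKr.
have := nuclear_triangle X (u^T *m v); rewrite -WE.
by have := cW u v; rewrite -inner_outer; lra.
Qed.

Lemma subgradient_inner m n (X Y : 'M[R]_(m, n)) :
  subdifferential (@nuclear_norm R m n) X Y -> inner Y X = nuclear_norm X.
Proof.
move=> /subdifferential_nuclear[cY XY]; apply/le_anti.
by rewrite XY contraction_le_nuclear.
Qed.

(** * Growth for a fixed subgradient *)

Lemma gamma_ge0 m n (Y : 'M[R]_(m, n)) : 0 <= gamma Y.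
Proof. exact: bigmax_ge_id. Qed.

Lemma gamma_ge m n (Y : 'M[R]_(m, n)) x :
  x \in singular_values Y -> x != 1 -> x <= gamma Y.
Proof. by move=> xY x1; exact: le_bigmax_seq. Qed.

Lemma contraction_singular_le1 m n (Y : 'M[R]_(m, n)) x :
  contraction Y -> x \in singular_values Y -> x <= 1.
Proof.
move=> cY; have [O [s svdY]] := left_svd_exists Y; have [_ s0 _ /perm_mem ->] := svdY.
case/mapP => i _ ->.
have := cY (row i O) (row i (O *m Y)).
rewrite -row_mul (svd_row_inner svdY) (svd_fro_basis svdY) (svd_fro_row svdY).
rewrite eqxx mulr1n mul1r; have := s0 i; have [->|si0 _] := eqVneq (s 0 i) 0.
  by rewrite ler01.
by rewrite expr2 -{3}[s 0 i]mul1r ler_pM2r// lt0r si0 s0.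
Qed.

Lemma gamma_lt1 m n (Y : 'M[R]_(m, n)) : contraction Y -> gamma Y < 1.
Proof.
move=> cY; rewrite /gamma big_seq_cond; apply: bigmax_lt => // x.
by case/andP => xY x1; rewrite lt_neqAle x1 (contraction_singular_le1 cY).
Qed.

(** P projects onto the left singular space of Y for the singular value 1; on its
    orthogonal complement Y has norm at most gamma Y. *)
Lemma unit_singular_projector m n (Y : 'M[R]_(m, n)) : exists P : 'M[R]_m,
  [/\ P^T = P, P *m P = P, Y *m Y^T *m P = P &
      forall u : 'rV[R]_m, u *m P = 0 ->
        inner (u *m Y) (u *m Y) <= gamma Y ^+ 2 * inner u u].
Proof.
have [O [s svdY]] := left_svd_exists Y; have [OO s0 GD _] := svdY.
have OTO := mulmx1C OO.
pose e : 'rV[R]_m := \row_i (s 0 i == 1)%:R.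
exists (O^T *m diag_mx e *m O); split.
- by rewrite !trmx_mul trmxK tr_diag_mx mulmxA.
- rewrite !mulmxA -(mulmxA _ O) OO mulmx1 -(mulmxA O^T) mulmx_diag.
  by congr (_ *m diag_mx _ *m _); apply/rowP => i; rewrite !mxE -natrM mulnb andbb.
- have -> : Y *m Y^T = O^T *m diag_mx (\row_i s 0 i ^+ 2) *m O.
    rewrite -GD trmx_mul !mulmxA OTO mul1mx -!mulmxA OTO.
    by rewrite mulmx1.
  rewrite !mulmxA -(mulmxA _ O) OO mulmx1 -(mulmxA O^T) mulmx_diag.
  congr (_ *m diag_mx _ *m _); apply/rowP => i; rewrite !mxE.
  by have [->|] := eqVneq (s 0 i) 1; rewrite ?mulr0// expr1n mulr1.
move=> u uP.
have ue i : s 0 i = 1 -> (u *m O^T) 0 i = 0.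
  move=> si; have /rowP/(_ i) : u *m O^T *m diag_mx e = 0.
    have : u *m (O^T *m diag_mx e *m O) *m O^T = 0 by rewrite uP mul0mx.
    by rewrite -!mulmxA OO mulmx1 mulmxA.
  by rewrite mul_mx_diag mxE [e _ _]mxE si eqxx mulr1 mxE => ->; rewrite mxE.
rewrite (svd_inner_mul svdY) (svd_inner_basis svdY) mulr_sumr.
apply: ler_sum => i _; have [si|si] := eqVneq (s 0 i) 1.
  by rewrite ue// expr0n !mulr0.
rewrite ler_wpM2r ?sqr_ge0// ler_sqr ?nnegrE ?gamma_ge0//.
by rewrite gamma_ge// (svd_mem svdY).
Qed.

Lemma projected_row m n (Y : 'M[R]_(m, n)) (P : 'M[R]_m) :
  P^T = P -> Y *m Y^T *m P = P ->
  forall u : 'rV[R]_m, u *m P = u -> u *m Y *m Y^T = u.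
Proof.
move=> symP GP u uP; have := congr1 trmx GP; rewrite !trmx_mul symP trmxK => PG.
by rewrite -mulmxA -{1}uP -mulmxA PG uP.
Qed.

(** Split p = a + p2 and q = b Y + q2 along the singular spaces of Y for the
    singular value 1, with a and b in the range of P. Then <pY, q> = <a, b> +
    <p2 Y, q2>, and the second term is at most g (|p2|^2 + |q2|^2) / 2. The
    midpoint c = (a + b) / 2 gives a matrix c^T c Y close to p^T q: c^T c is a
    positive semidefinite approximation of a^T b. This leaves an inequality
    between |a|^2, |b|^2 and <a, b>. *)
Lemma rank_one_growth m n (Y : 'M[R]_(m, n)) (P : 'M[R]_m) (g : R)
    (p : 'rV[R]_m) (q : 'rV[R]_n) :
  P^T = P -> P *m P = P -> Y *m Y^T *m P = P ->
  (forall u : 'rV[R]_m, u *m P = 0 ->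
     inner (u *m Y) (u *m Y) <= g ^+ 2 * inner u u) ->
  0 <= g <= 1 -> inner p p = 1 -> inner q q = 1 ->
  exists2 c : 'rV[R]_m, c *m P = c &
    (1 - g) / 2 * inner (p^T *m q - c^T *m (c *m Y)) (p^T *m q - c^T *m (c *m Y))
      <= 1 - inner (p *m Y) q.
Proof.
move=> symP PP GP Pg /andP[g0 g1] p1 q1.
have GP_row := projected_row symP GP.
pose a : 'rV[R]_m := p *m P; pose b : 'rV[R]_m := q *m Y^T *m P.
have aP : a *m P = a by rewrite /a -mulmxA PP.
have bP : b *m P = b by rewrite /b -mulmxA PP.
have inner_aP (u v : 'rV[R]_m) : inner (u *m P) v = inner u (v *m P).
  by rewrite inner_mulr symP.
have pE (x : 'rV[R]_m) : x *m P = x -> inner p x = inner a x.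
  by move=> xP; rewrite -{1}xP -inner_aP.
have qE (x : 'rV[R]_m) : x *m P = x -> inner (x *m Y) q = inner x b.
  by move=> xP; rewrite inner_mulr -{1}xP inner_aP.
have pP : p *m P = a by [].
clearbody a b.
have bYbY : inner (b *m Y) (b *m Y) = inner b b.
  by rewrite inner_mulr GP_row.
pose p2 : 'rV[R]_m := p - a; pose q2 : 'rV[R]_n := q - b *m Y.
have p2P : p2 *m P = 0 by rewrite /p2 mulmxBl pP aP subrr.
have p2p2 : inner p2 p2 = 1 - inner a a.
  by rewrite (inner_sqrB p a) (pE a)// p1; ring.
have q2q2 : inner q2 q2 = 1 - inner b b.
  by rewrite (inner_sqrB q (b *m Y)) (innerC q) (qE b)// bYbY q1; ring.
have p2b : inner (p2 *m Y) (b *m Y) = 0.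
  by rewrite inner_mulr GP_row// -bP -inner_aP p2P inner0l.
have pYq : inner (p *m Y) q = inner a b + inner (p2 *m Y) q2.
  have -> : inner (p2 *m Y) q2 = inner (p2 *m Y) q - inner (p2 *m Y) (b *m Y).
    exact: innerBr.
  have -> : inner (p2 *m Y) q = inner (p *m Y) q - inner (a *m Y) q.
    by rewrite /p2 mulmxBl; exact: innerBl.
  by rewrite p2b (qE a)//; ring.
clearbody p2 q2.
have cross : inner (p2 *m Y) q2 <= g / 2 * (inner p2 p2 + inner q2 q2).
  have B0 : 0 <= g / 2 * (inner p2 p2 + inner q2 q2).
    by rewrite mulr_ge0 ?divr_ge0// addr_ge0 ?inner_ge0.
  have [x0|pq0] := leP (inner (p2 *m Y) q2) 0; first exact: le_trans B0.
  rewrite -ler_sqr ?nnegrE ?(ltW pq0)//; apply: le_trans (inner_cauchy _ _) _.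
  apply: le_trans (ler_wpM2r (inner_ge0 _) (Pg _ p2P)) _.
  have := mulr_ge0 (sqr_ge0 g) (sqr_ge0 (inner p2 p2 - inner q2 q2)); nra.
pose c : 'rV[R]_m := 2^-1 *: (a + b).
have cP : c *m P = c by rewrite /c -scalemxAl mulmxDl aP bP.
exists c => //.
have normZ : inner (p^T *m q - c^T *m (c *m Y)) (p^T *m q - c^T *m (c *m Y))
    = 1 - 2 * (inner a c * inner b c) + inner c c ^+ 2.
  have cYcY : inner (c *m Y) (c *m Y) = inner c c by rewrite inner_mulr GP_row.
  rewrite (inner_sqrB (p^T *m q) (c^T *m (c *m Y))) !inner_outer_outer (innerC q (c *m Y)).
  rewrite (pE c)// (qE c)// (innerC c b) cYcY p1 q1.
  by ring.
have ab2 : (inner a a - inner b b) ^+ 2 <=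
    (inner a a - 2 * inner a b + inner b b) * (inner a a + 2 * inner a b + inner b b).
  have := inner_cauchy (a - b) (a + b); rewrite !inner_lin (innerC b a); nra.
have diff0 := inner_ge0 (a - b); have sum0 := inner_ge0 (a + b).
have a1 : inner a a <= 1 by rewrite -subr_ge0 -p2p2 inner_ge0.
have b1 : inner b b <= 1 by rewrite -subr_ge0 -q2q2 inner_ge0.
rewrite normZ pYq p2p2 q2q2 in cross *.
rewrite /c !inner_lin (innerC b a) in diff0 sum0 *.
move: (inner (p2 *m Y) q2) cross => x cross.
move: (inner a a) (inner b b) (inner a b) ab2 diff0 sum0 a1 b1 cross
  => A B t ab2 diff0 sum0 a1 b1 cross.
(* With S = (A + B) / 2, the left side equals 1 - (S + t)^2 / 4 + (A - B)^2 / 8,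
   and ab2 says that (A - B)^2 <= 4 (S - t) (S + t) with S + t <= 2. *)
have N_le : 1 - 2 * (2^-1 * (A + t) * (2^-1 * (t + B)))
    + (2^-1 * (2^-1 * (A + t) + 2^-1 * (t + B))) ^+ 2 <= 2 * (1 - t).
  by nra.
(* t <= S, so the loss g (1 - S) from cross is at most g (1 - t). *)
have gd : 0 <= g * (A - 2 * t + B) by rewrite mulr_ge0//; lra.
have := ler_wpM2l (_ : 0 <= (1 - g) / 2) N_le.
move: (1 - _ + _) => N /(_ ltac:(lra)); nra.
Qed.

(** The hypothesis S Z makes S nonempty, so dist X S is nonnegative and can be
    squared. *)
Lemma dist_sqr_le m n (X Z : 'M[R]_(m, n)) (S : set 'M[R]_(m, n)) :
  S Z -> dist X S ^+ 2 <= inner (X - Z) (X - Z).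
Proof.
move=> SZ.
have lb0 : lbound [set fro_norm (X - Z') | Z' in S] 0.
  by move=> _ [Z' _ <-]; exact: fro_ge0.
have d0 : 0 <= dist X S.
  by apply: lb_le_inf => //; exists (fro_norm (X - Z)), Z.
rewrite -sqr_fro ler_sqr ?nnegrE ?fro_ge0//.
by apply: ge_inf; [exists 0|exists Z].
Qed.

(** The rank-one estimate summed over a singular value decomposition of X.
    Keeping ||X||_* as a factor on the right makes the inequality meaningful at
    X = 0 as well. *)
Lemma nuclear_growth m n (Y X : 'M[R]_(m, n)) : contraction Y ->
  (1 - gamma Y) / 2 * dist X (subdifferential_inv (@nuclear_norm R m n) Y) ^+ 2
    <= nuclear_norm X * (nuclear_norm X - inner Y X).
Proof.
move=> cY; set g := gamma Y.
have g1 : 0 <= g <= 1 by rewrite gamma_ge0 ltW// gamma_lt1.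
have c0 : 0 <= (1 - g) / 2 by move: g1; lra.
have [P [symP PP GP Pg]] := unit_singular_projector Y.
have GP_row := projected_row symP GP.
have [O [s svdX]] := left_svd_exists X; have [_ s0 _ _] := svdX.
(* q i = 0 when s_i = 0; such terms carry weight 0, so c = 0 serves there. *)
pose p i := row i O; pose q i := (s 0 i)^-1 *: row i (O *m X).
have sq i : s 0 i *: q i = row i (O *m X).
  rewrite /q scalerA; have [si0|si0] := eqVneq (s 0 i) 0; last first.
    by rewrite divff// scale1r.
  rewrite si0 mul0r scale0r; apply/esym/inner_eq0.
  by rewrite (svd_row_inner svdX) si0 expr0n mul0rn.
have /fin_all_exists[c cP] i : exists c : 'rV[R]_m, c *m P = c /\
    s 0 i * ((1 - g) / 2 * inner ((p i)^T *m q i - c^T *m (c *m Y))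
                                 ((p i)^T *m q i - c^T *m (c *m Y)))
    <= s 0 i * (1 - inner (p i *m Y) (q i)).
  have [si0|si0] := eqVneq (s 0 i) 0.
    by exists 0; rewrite mul0mx si0 !mul0r.
  have p1 : inner (p i) (p i) = 1 by rewrite -sqr_fro (svd_fro_basis svdX) expr1n.
  have q1 : inner (q i) (q i) = 1.
    by rewrite innerZl innerZr (svd_row_inner svdX) eqxx mulr1n; field.
  have [c cP le_c] := rank_one_growth symP PP GP Pg g1 p1 q1.
  by exists c; split=> //; rewrite ler_wpM2l.
pose Zi i := (c i)^T *m (c i *m Y).
pose Z := \sum_i s 0 i *: Zi i.
have SZ : subdifferential_inv (@nuclear_norm R m n) Y Z.
  apply/subdifferential_nuclear; split=> //.
  have [W cW <-] := nuclear_attained Z.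
  rewrite !inner_sumr; apply: ler_sum => i _; rewrite !innerZr ler_wpM2l//.
  rewrite !inner_outer; apply: le_trans (cW _ _) _.
  have cYcY : inner (c i *m Y) (c i *m Y) = inner (c i) (c i).
    by rewrite inner_mulr GP_row//; case: (cP i).
  by rewrite /fro_norm cYcY -expr2 sqr_sqrtr// inner_ge0.
have XZ : X - Z = \sum_i s 0 i *: ((p i)^T *m q i - Zi i).
  rewrite {1}(svd_sum svdX) -sumrB; apply: eq_bigr => i _.
  by rewrite -sq scalerBr -scalemxAr.
have deficit : nuclear_norm X - inner Y X
    = \sum_i s 0 i * (1 - inner (p i *m Y) (q i)).
  rewrite (svd_nuclear svdX) (svd_inner svdX) -sumrB; apply: eq_bigr => i _.
  by rewrite -sq innerZr; ring.
apply: le_trans (ler_wpM2l c0 (dist_sqr_le X SZ)) _.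
rewrite XZ; apply: le_trans (ler_wpM2l c0 (inner_jensen _ s0)) _.
rewrite mulrCA deficit (svd_nuclear svdX) ler_wpM2l ?sumr_ge0//.
rewrite mulr_sumr; apply: ler_sum => i _; rewrite mulrCA.
by case: (cP i).
Qed.

(** * Perturbation of the largest singular value different from 1 *)

(** The constraints are #|J'| linear equations in #|J| unknowns. *)
Lemma supported_vector n (K : 'M[R]_n) (J J' : {pred 'I_n}) : (#|J'| < #|J|)%N ->
  exists c : 'rV[R]_n, [/\ c != 0, forall i, i \notin J -> c 0 i = 0 &
    forall i, i \in J' -> (c *m K) 0 i = 0].
Proof.
move=> ltJ.
pose E : 'M[R]_(#|J|, n) := \matrix_(i, j) (enum_val i == j)%:R.
pose F : 'M[R]_(n, #|J'|) := \matrix_(i, j) K i (enum_val j).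
have : kermx (E *m F) != 0.
  rewrite -mxrank_eq0 mxrank_ker subn_eq0 -ltnNge.
  exact: leq_ltn_trans (rank_leq_col _) ltJ.
case/rowV0Pn => v /sub_kermxP vEF v0.
have vE k : (v *m E) 0 (enum_val k) = v 0 k.
  rewrite mxE (bigD1 k)//= big1 => [|l /negPf lk]; rewrite !mxE.
    by rewrite eqxx mulr1 addr0.
  by rewrite (inj_eq enum_val_inj) lk mulr0.
exists (v *m E); split.
- by apply: contraNneq v0 => vE0; apply/eqP/rowP => k; rewrite -vE vE0 !mxE.
- move=> i iJ; rewrite mxE big1// => k _; rewrite mxE.
  by case: eqP => [ki|]; rewrite ?mulr0//; rewrite -ki enum_valP in iJ.
- move=> i iJ'; have /rowP/(_ (enum_rank_in iJ' i)) := vEF.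
  rewrite mulmxA mxE [RHS]mxE => <-; rewrite mxE; apply: eq_bigr => k _.
  by rewrite [F _ _]mxE enum_rankK_in.
Qed.

(** Suppose that a singular value x != 1 of Y' exceeds the bound. The left
    singular vectors of Y' for x and for the value 1 span a space of dimension
    larger than the multiplicity of 1 for Y. It therefore contains a nonzero v
    orthogonal to the left singular vectors of Y for the value 1. Then
    x |v| <= |v Y'| <= |v Y| + |v (Y' - Y)| <= (gamma Y + |Y' - Y|) |v|, a
    contradiction. *)
Lemma gamma_perturb m n (Y Y' : 'M[R]_(m, n)) : contraction Y' ->
  (num_sigma1 Y <= num_sigma1 Y')%N -> gamma Y' <= gamma Y + fro_norm (Y' - Y).
Proof.
move=> cY' le_count.
have bound0 : 0 <= gamma Y + fro_norm (Y' - Y) by rewrite addr_ge0 ?gamma_ge0 ?fro_ge0.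
rewrite /gamma big_seq_cond; apply: bigmax_le => // x /andP[xY' x1].
rewrite -/(gamma Y) leNgt; apply/negP => lt_x.
have [O [s svdY]] := left_svd_exists Y; have [O' [s' svdY']] := left_svd_exists Y'.
have [_ s0 _ _] := svdY; have [OO' s'0 _ sE] := svdY'.
have [i0 _ xE] : exists2 i, i \in enum 'I_m & x = s' 0 i.
  by apply/mapP; rewrite -(perm_mem sE).
(* J' indexes the unit singular values of Y; J those of Y' together with x. *)
pose J' := [pred i : 'I_m | s 0 i == 1].
pose J := [pred i : 'I_m | (i == i0) || (s' 0 i == 1)].
have ltJ : (#|J'| < #|J|)%N.
  rewrite -(svd_count svdY) (cardD1 i0) inE eqxx /= add1n ltnS.
  apply: leq_trans le_count _; rewrite /num_sigma1 (svd_count svdY').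
  apply: subset_leq_card; apply/fintype.subsetP => i; rewrite !inE => si1.
  by rewrite si1 orbT andbT; apply: contraNneq x1 => ii0; rewrite xE -ii0.
have [c [c0 cJ cJ']] := supported_vector (O' *m O^T) ltJ.
pose v := c *m O'.
have vO' : v *m O'^T = c by rewrite /v -mulmxA OO' mulmx1.
have vv : inner v v = \sum_i c 0 i ^+ 2 by rewrite (svd_inner_basis svdY') vO'.
have v0 : 0 < fro_norm v.
  rewrite lt0r fro_ge0 andbT; apply: contra_neq c0 => fv0.
  have /inner_eq0 v0 : inner v v = 0 by rewrite -sqr_fro fv0 expr0n.
  by rewrite -vO' v0 mul0mx.
have lower : x * fro_norm v <= fro_norm (v *m Y').
  have x0 : 0 <= x by exact: singular_values_ge0 xY'.
  rewrite -ler_sqr ?nnegrE ?mulr_ge0 ?fro_ge0// exprMn !sqr_fro.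
  rewrite (svd_inner_mul svdY') vO' vv mulr_sumr; apply: ler_sum => i _.
  have [iJ|iJ] := boolP (i \in J); last by rewrite cJ// expr0n !mulr0.
  rewrite ler_wpM2r ?sqr_ge0// ler_sqr ?nnegrE//.
  case/orP: iJ => /eqP -> //; first by rewrite xE.
  exact: contraction_singular_le1 cY' xY'.
have upper : fro_norm (v *m Y) <= gamma Y * fro_norm v.
  rewrite -ler_sqr ?nnegrE ?mulr_ge0 ?fro_ge0 ?gamma_ge0// exprMn !sqr_fro.
  rewrite (svd_inner_mul svdY) (svd_inner_basis svdY) mulr_sumr.
  apply: ler_sum => i _; have [si|si] := eqVneq (s 0 i) 1.
    by rewrite /v -mulmxA cJ' ?inE ?si// expr0n !mulr0.
  rewrite ler_wpM2r ?sqr_ge0// ler_sqr ?nnegrE ?gamma_ge0//.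
  by rewrite gamma_ge// (svd_mem svdY).
have split_v : v *m Y' = v *m Y + v *m (Y' - Y) by rewrite mulmxBr addrC subrK.
have := fro_triangle (v *m Y) (v *m (Y' - Y)); rewrite -split_v.
have := fro_mul v (Y' - Y); move: lt_x; rewrite -(ltr_pM2r v0); lra.
Qed.

(** * Quadratic growth around a pair *)

Lemma sorted_ones (t : seq R) : sorted (fun x y => y <= x) t ->
  {in t, forall x, x <= 1} -> forall i, (i < count_mem 1%R t)%N -> nth 0 t i = 1.
Proof.
elim: t => [//|a t IHt] sat t1 i /=.
have [a1|a1] := eqVneq a 1.
  case: i => [//|i]; rewrite add1n ltnS; apply: IHt; first exact: path_sorted sat.
  by move=> x xt; rewrite t1// inE xt orbT.
rewrite (_ : count_mem 1 t = 0%N) //; apply/eqP; rewrite -leqn0 leqNgt -has_count.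
apply/hasPn => x xt /=; rewrite lt_eqF//; apply: le_lt_trans (_ : a < 1).
  have := order_path_min _ sat; move=> /(_ (fun y x z yx zy => le_trans zy yx)).
  by move=> /allP/(_ x xt).
by rewrite lt_neqAle a1 t1// mem_head.
Qed.

(** The default value 0 of nth differs from 1, so the p entries are real entries
    of the list. *)
Lemma count_ones_ge (t : seq R) p :
  (forall i, (i < p)%N -> nth 0 t i = 1) -> (p <= count_mem 1%R t)%N.
Proof.
elim: t p => [|a t IHt] [|p]// tp.
  by have /eqP := tp 0%N isT; rewrite eq_sym oner_eq0.
have -> : a = 1 := tp 0%N isT.
by rewrite /= eqxx add1n ltnS; apply: IHt => i ip; exact: (tp i.+1).
Qed.

End NuclearNorm.

Theorem lemma4p2 (R : realType) (n1 n2 : nat) (hn : (n1 <= n2)%N)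
    (Xbar Ybar : 'M[R]_(n1, n2))
    (hY : subdifferential (@nuclear_norm R n1 n2) Xbar Ybar) :
  [/\ gamma Ybar < 1,
      forall X : 'M[R]_(n1, n2), X != 0 ->
        (1 - gamma Ybar ^+ 2)
            / (2 * nuclear_norm X * (1 + (1 + gamma Ybar) ^+ 2))
          * dist X (subdifferential_inv (@nuclear_norm R n1 n2) Ybar) ^+ 2
        <= nuclear_norm X - nuclear_norm Xbar - inner Ybar (X - Xbar),
      forall X : 'M[R]_(n1, n2), X != 0 ->
        (1 - gamma Ybar) / (5 * nuclear_norm X)
          * dist X (subdifferential_inv (@nuclear_norm R n1 n2) Ybar) ^+ 2
        <= nuclear_norm X - nuclear_norm Xbar - inner Ybar (X - Xbar)
    & quadratic_growth_around (@nuclear_norm R n1 n2) Xbar Ybar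
        (@Mstar R n1 n2 (num_sigma1 Ybar))].
Proof.
have [cY _] := (subdifferential_nuclear Xbar Ybar).1 hY.
have g1 := gamma_lt1 cY; have g0 := gamma_ge0 Ybar.
have growth X := nuclear_growth X cY.
have perturb y cy := @gamma_perturb R n1 n2 Ybar y cy.
move: (gamma Ybar) g1 g0 growth perturb => g g1 g0 growth perturb.
have gap (x y u : 'M[R]_(n1, n2)) : subdifferential (@nuclear_norm R n1 n2) x y ->
    nuclear_norm u - nuclear_norm x - inner y (u - x) = nuclear_norm u - inner y u.
  by move=> /subgradient_inner xy; rewrite innerBr xy; ring.
have half_growth X : X != 0 ->
    (1 - g) / (2 * nuclear_norm X)
      * dist X (subdifferential_inv (@nuclear_norm R n1 n2) Ybar) ^+ 2
    <= nuclear_norm X - inner Ybar X.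
  move=> /nuclear_gt0 X0; rewrite -(ler_pM2l X0).
  apply: le_trans (growth X); rewrite mulrA ler_wpM2r ?sqr_ge0//.
  by rewrite le_eqVlt; apply/orP; left; apply/eqP; field; rewrite gt_eqF.
split=> //.
- move=> X X0; have nX := nuclear_gt0 X0; rewrite gap//.
  apply: le_trans (half_growth X X0); rewrite ler_wpM2r ?sqr_ge0//.
  rewrite ler_pdivrMr ?mulr_gt0//; last by nra.
  have -> : (1 - g) / (2 * nuclear_norm X) *
      (2 * nuclear_norm X * (1 + (1 + g) ^+ 2)) = (1 - g) * (1 + (1 + g) ^+ 2).
    by field; rewrite gt_eqF.
  by nra.
- move=> X X0; have nX := nuclear_gt0 X0; rewrite gap//.
  apply: le_trans (half_growth X X0); rewrite ler_wpM2r ?sqr_ge0//.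
  apply: ler_wpM2l; first lra.
  rewrite lef_pV2 ?posrE ?mulr_gt0//.
  by rewrite ler_pM2r// ler_nat.
have srt : sorted (fun x y : R => y <= x) (singular_values Ybar).
  by apply: sort_sorted => x y; exact: le_total.
split=> //.
  move=> i; apply: sorted_ones => // x; exact: contraction_singular_le1.
(* M bounds ||u||_* when |u - x| < 1 and |x - Xbar| < 1. *)
pose M := nuclear_norm Xbar + 2 * n1%:R + 1.
have M0 : 0 < M by have := nuclear_ge0 Xbar; have := ler0n R n1; rewrite /M; lra.
(* With eta = (1 - g) / 2, the perturbation bound gives gamma y <= (1 + g) / 2. *)
exists ((1 - g) / 2), ((1 - g) / (2 * M)); split; first lra.
  by rewrite divr_gt0 ?mulr_gt0//; lra.
move=> x y xy near My.
have lt_sqrt (a b : R) : 0 <= a -> 0 <= b ->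
    a <= Num.sqrt (a ^+ 2 + b ^+ 2) /\ b <= Num.sqrt (a ^+ 2 + b ^+ 2).
  move=> a0 b0; split; [rewrite -{1}(ger0_norm a0)|rewrite -{1}(ger0_norm b0)];
    by rewrite -sqrtr_sqr ler_sqrt ?addr_ge0 ?sqr_ge0// ?lerDl ?lerDr sqr_ge0.
have [/le_lt_trans/(_ near) xnear /le_lt_trans/(_ near) ynear] :=
  lt_sqrt _ _ (fro_ge0 (x - Xbar)) (fro_ge0 (y - Ybar)).
have [cy _] := (subdifferential_nuclear x y).1 xy.
have gy : gamma y <= (1 + g) / 2.
  have := perturb y cy (count_ones_ge My); lra.
split=> //; first by rewrite divr_gt0 ?mulr_gt0//; lra.
exists 1 => // u unear; rewrite gap//.
have uM : nuclear_norm u <= M.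
  have small (z : 'M[R]_(n1, n2)) : fro_norm z <= 1 -> nuclear_norm z <= n1%:R :> R.
    move=> z1; apply: le_trans (nuclear_le_fro z) _.
    by rewrite ler_piMr.
  have uE : u = Xbar + ((u - x) + (x - Xbar)) by rewrite subrKA addrC subrK.
  rewrite [in leLHS]uE; apply: le_trans (nuclear_triangle _ _) _.
  rewrite /M -[leRHS]addrA lerD2l; apply: le_trans (nuclear_triangle _ _) _.
  apply: le_trans (lerD (small _ (ltW unear)) (small _ _)) _; first lra.
  by rewrite mulr_natl mulr2n lerDl.
have coef : (1 - g) / 4 <= (1 - gamma y) / 2 by lra.
have := nuclear_growth u cy.
set D := dist _ _ ^+ 2; have D0 : 0 <= D by exact: sqr_ge0.
have := contraction_le_nuclear u cy; rewrite -subr_ge0.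
move: (nuclear_norm u - inner y u) => delta delta0 growth_u.
rewrite -(ler_pM2l M0); have -> : M * ((1 - g) / (2 * M) / 2 * D) = (1 - g) / 4 * D.
  by field; rewrite gt_eqF.
apply: le_trans (ler_wpM2r delta0 uM); apply: le_trans growth_u.
by rewrite ler_wpM2r.
Qed.
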